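(* Let $(A,\cdot,\circ)$ and $(B,\cdot,\circ)$ be isoclinic skew left braces. If $$\mathrm{Ann}(\widetilde A)=\mathrm{Ann}(A)\times\mathrm{Ann}(A)\quad\text{and}\quad\mathrm{Ann}(\widetilde B)=\mathrm{Ann}(B)\times\mathrm{Ann}(B),$$ then the squares $(\widetilde A,\bullet,\odot)$ and $(\widetilde B,\bullet,\odot)$ are also isoclinic.
   Context: A skew left brace is $(H,\cdot,\circ)$ with $(H,\cdot)$, $(H,\circ)$ groups and $a\circ(b\cdot c)=(a\circ b)\cdot a^{-1}\cdot(a\circ c)$; $a^{-1}$, $a^\dagger$ are the inverses in $(H,\cdot)$, $(H,\circ)$; $\lambda^H_a(b)=a^{-1}\cdot(a\circ b)$. The square of $(H,\cdot,\circ)$ is the skew left brace $(\widetilde H,\bullet,\odot)$ on the set $\widetilde H=H\times H$ with $(h_1,g_1)\bullet(h_2,g_2)=(h_1\cdot\lambda^H_{g_1}(h_2),\ g_1\circ g_2)$ (additive) and $(h_1,g_1)\odot(h_2,g_2)=(h_1\circ h_2,\ h_1\circ g_2\circ h_1^\dagger\circ g_1)$ (multiplicative). The annihilator is $\mathrm{Ann}(H)=\{a\in H\mid b\circ a=a\circ b=b\cdot a=a\cdot b\text{ for all }b\in H\}$. The commutator $H'$ is the subgroup of $(H,\cdot)$ generated by the commutator subgroup of $(H,\cdot)$ and the set $\{a^{-1}\cdot(a\circ b)\cdot b^{-1}\mid a,b\in H\}$. Both are ideals of $H$ (normal subgroups of both groups, stable under all $\lambda^H_h$), so $H/\mathrm{Ann}(H)$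 and $H'$ are skew left braces. Skew left braces $A$ and $B$ are isoclinic if there are skew brace isomorphisms $\xi_1:A/\mathrm{Ann}(A)\to B/\mathrm{Ann}(B)$ and $\xi_2:A'\to B'$ with $\xi_2\theta_A=\theta_B(\xi_1\times\xi_1)$ and $\xi_2\theta_A^*=\theta_B^*(\xi_1\times\xi_1)$, where $\theta_A,\theta_A^*:(A/\mathrm{Ann}(A))\times(A/\mathrm{Ann}(A))\to A'$ are $\theta_A(\overline a,\overline b)=a\cdot b\cdot a^{-1}\cdot b^{-1}$ and $\theta_A^*(\overline a,\overline b)=\lambda^A_a(b)\cdot b^{-1}$, and similarly for $B$. *)

(* Defs.v *)
From HB Require Import structures.
From mathcomp Require Import all_boot.
From mathcomp Require Import boolp classical_sets.

Set Implicit Arguments.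
Unset Strict Implicit.
Unset Printing Implicit Defensive.

Local Open Scope classical_set_scope.
Local Open Scope group_scope.

(* A skew left brace is a (possibly infinite) group, written multiplicatively
   as in monoid.v and called "additive", together with a second group
   structure [circ], [cone], [cinv] on the same carrier. The two neutral
   elements are not assumed to agree; see [cone1]. *)
HB.mixin Record Group_isSkewLeftBrace H of Group H := {
  circ : H -> H -> H;
  cone : H;
  cinv : H -> H;
  circA : associative circ;
  circ1x : left_id cone circ;
  circx1 : right_id cone circ;
  circVx : left_inverse cone cinv circ;
  circxV : right_inverse cone cinv circ;
  circM : forall a b c : H, circ a (b * c) = circ a b * a^-1 * circ a c
}.

#[short(type="skewLeftBraceType")]
HB.structure Definition SkewLeftBrace :=
  {H of Group_isSkewLeftBrace H & Group H}.

Notation "x ∘ y" := (circ x y) (at level 40, left associativity) : group_scope.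
Notation "x ^†" := (cinv x) (at level 1, left associativity, format "x ^†") :
  group_scope.

Definition lam (H : skewLeftBraceType) (a b : H) : H := a^-1 * (a ∘ b).

Section BasicTheory.
Variable H : skewLeftBraceType.
Implicit Types a b c x y : H.

Lemma lamM a b c : lam a (b * c) = lam a b * lam a c.
Proof. by rewrite /lam circM !mulgA. Qed.

Lemma circE a b : a ∘ b = a * lam a b.
Proof. by rewrite /lam mulVKg. Qed.

Lemma lam1 a : lam a 1 = 1.
Proof. by apply: (@mulgI _ (lam a 1)); rewrite -lamM !mulg1. Qed.

Lemma lamV a b : lam a b^-1 = (lam a b)^-1.
Proof. by apply/esym/mulg1_eq; rewrite -lamM mulgV lam1. Qed.

Lemma circ1r a : a ∘ 1 = a.
Proof. by rewrite circE lam1 mulg1. Qed.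

Lemma cone1 : cone = 1 :> H.
Proof. by rewrite -[LHS]circ1r circ1x. Qed.

Lemma circ1l a : 1 ∘ a = a.
Proof. by rewrite -cone1 circ1x. Qed.

Lemma circxV1 a : a ∘ a^† = 1.
Proof. by rewrite circxV cone1. Qed.

Lemma circVx1 a : a^† ∘ a = 1.
Proof. by rewrite circVx cone1. Qed.

Lemma circK a b : a^† ∘ (a ∘ b) = b.
Proof. by rewrite circA circVx1 circ1l. Qed.

Lemma circVK a b : a ∘ (a^† ∘ b) = b.
Proof. by rewrite circA circxV1 circ1l. Qed.

Lemma circKr a b : b ∘ a ∘ a^† = b.
Proof. by rewrite -circA circxV1 circ1r. Qed.

Lemma circVKr a b : b ∘ a^† ∘ a = b.
Proof. by rewrite -circA circVx1 circ1r. Qed.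

Lemma cinvE a b : a ∘ b = 1 -> a^† = b.
Proof. by move=> ab; rewrite -[RHS](circK a) ab circ1r. Qed.

Lemma cinvK a : a^†^† = a.
Proof. exact/cinvE/circVx1. Qed.

Lemma lam_circ a b c : lam (a ∘ b) c = lam a (lam b c).
Proof.
by apply: (@mulgI _ (a ∘ b)); rewrite -circE [in RHS]circE -mulgA -lamM -!circE circA.
Qed.

Lemma lam1x b : lam 1 b = b.
Proof. by rewrite /lam invg1 mul1g circ1l. Qed.

Lemma cinv_lam a : a^† = (lam a^† a)^-1.
Proof. by rewrite /lam circVx1 mulg1 invgK. Qed.

End BasicTheory.

Definition subgroup (T : Type) (mul : T -> T -> T) (one : T) (inv : T -> T)
    (S : set T) : Prop :=
  [/\ S one, forall x y, S x -> S y -> S (mul x y) & forall x, S x -> S (inv x)].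

Definition normal_subgroup (T : Type) (mul : T -> T -> T) (one : T)
    (inv : T -> T) (S : set T) : Prop :=
  subgroup mul one inv S /\ forall h x, S x -> S (mul (mul h x) (inv h)).

Record ideal (H : skewLeftBraceType) := Ideal {
  ideal_set :> set H;
  ideal_add_normal : normal_subgroup mul 1 inv ideal_set;
  ideal_circ_normal : normal_subgroup (@circ H) cone cinv ideal_set;
  ideal_lam : forall h x : H, ideal_set x -> ideal_set (lam h x)
}.

Section MkIdeal.
Variables (H : skewLeftBraceType) (I : set H).
Hypothesis addI : normal_subgroup mul 1 inv I.
Hypothesis lamI : forall h x : H, I x -> I (lam h x).
Hypothesis conjI : forall h x : H, I x -> I (h ∘ x ∘ h^†).

Lemma mk_circ_normal : normal_subgroup (@circ H) cone cinv I.
Proof.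
case: addI => -[I1 IM IV] _; split=> //; split; first by rewrite cone1.
  by move=> x y Ix Iy; rewrite circE; apply: IM => //; apply: lamI.
by move=> x Ix; rewrite cinv_lam; apply/IV/lamI.
Qed.

Definition mk_ideal : ideal H := Ideal addI mk_circ_normal lamI.
End MkIdeal.

Section SubBrace.
Variables (H : skewLeftBraceType) (I : ideal H).

Definition sub_brace : Type := {x : H | x \in (I : set H)}.

HB.instance Definition _ := Choice.on sub_brace.
HB.instance Definition _ := SubType.on sub_brace.

Implicit Types x y z : sub_brace.

Definition sub_mk (h : H) (Ih : (I : set H) h) : sub_brace := SigSub (mem_set Ih).

Lemma subP x : (I : set H) (val x).
Proof. exact/set_mem/(valP x). Qed.

Lemma sub_one_subproof : (I : set H) 1.
Proof. by case: (ideal_add_normal I) => -[]. Qed.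

Lemma sub_mul_subproof x y : (I : set H) (val x * val y).
Proof. by case: (ideal_add_normal I) => -[_ IM _] _; apply: IM; apply: subP. Qed.

Lemma sub_inv_subproof x : (I : set H) (val x)^-1.
Proof. by case: (ideal_add_normal I) => -[_ _ IV] _; apply: IV; apply: subP. Qed.

Lemma sub_cone_subproof : (I : set H) cone.
Proof. by case: (ideal_circ_normal I) => -[]. Qed.

Lemma sub_circ_subproof x y : (I : set H) (val x ∘ val y).
Proof. by case: (ideal_circ_normal I) => -[_ IM _] _; apply: IM; apply: subP. Qed.

Lemma sub_cinv_subproof x : (I : set H) (val x)^†.
Proof. by case: (ideal_circ_normal I) => -[_ _ IV] _; apply: IV; apply: subP. Qed.

Definition sub_one := sub_mk sub_one_subproof.
Definition sub_mul x y := sub_mk (sub_mul_subproof x y).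
Definition sub_inv x := sub_mk (sub_inv_subproof x).
Definition sub_cone := sub_mk sub_cone_subproof.
Definition sub_circ x y := sub_mk (sub_circ_subproof x y).
Definition sub_cinv x := sub_mk (sub_cinv_subproof x).

Lemma sub_mulA : associative sub_mul.
Proof. by move=> x y z; apply: val_inj; apply: mulgA. Qed.
Lemma sub_mul1 : left_id sub_one sub_mul.
Proof. by move=> x; apply: val_inj; apply: mul1g. Qed.
Lemma sub_mulx1 : right_id sub_one sub_mul.
Proof. by move=> x; apply: val_inj; apply: mulg1. Qed.
Lemma sub_mulV : left_inverse sub_one sub_inv sub_mul.
Proof. by move=> x; apply: val_inj; apply: mulVg. Qed.
Lemma sub_mulxV : right_inverse sub_one sub_inv sub_mul.
Proof. by move=> x; apply: val_inj; apply: mulgV. Qed.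

HB.instance Definition _ := isGroup.Build sub_brace
  sub_mulA sub_mul1 sub_mulx1 sub_mulV sub_mulxV.

Lemma sub_circA : associative sub_circ.
Proof. by move=> x y z; apply: val_inj; apply: circA. Qed.
Lemma sub_circ1 : left_id sub_cone sub_circ.
Proof. by move=> x; apply: val_inj; apply: circ1x. Qed.
Lemma sub_circx1 : right_id sub_cone sub_circ.
Proof. by move=> x; apply: val_inj; apply: circx1. Qed.
Lemma sub_circV : left_inverse sub_cone sub_cinv sub_circ.
Proof. by move=> x; apply: val_inj; apply: circVx. Qed.
Lemma sub_circxV : right_inverse sub_cone sub_cinv sub_circ.
Proof. by move=> x; apply: val_inj; apply: circxV. Qed.
Lemma sub_circM x y z :
  sub_circ x (y * z) = sub_circ x y * x^-1 * sub_circ x z.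
Proof. by apply: val_inj; apply: circM. Qed.

HB.instance Definition _ := Group_isSkewLeftBrace.Build sub_brace
  sub_circA sub_circ1 sub_circx1 sub_circV sub_circxV sub_circM.

End SubBrace.

Section QuotientBrace.
Variables (H : skewLeftBraceType) (I : ideal H).
Local Open Scope quotient_scope.

Definition ideal_rel (x y : H) : bool := `[< (I : set H) (x^-1 * y) >].

Lemma ideal_rel_refl : reflexive ideal_rel.
Proof.
by move=> x; apply/asboolP; rewrite mulVg; case: (ideal_add_normal I) => -[].
Qed.

Lemma ideal_rel_sym : symmetric ideal_rel.
Proof.
case: (ideal_add_normal I) => -[_ _ IV] _.
by move=> x y; apply/asboolP/asboolP => /IV; rewrite invgM invgK.
Qed.

Lemma ideal_rel_trans : transitive ideal_rel.
Proof.
case: (ideal_add_normal I) => -[_ IM _] _.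
move=> y x z /asboolP xy /asboolP yz; apply/asboolP.
by have := IM _ _ xy yz; rewrite -mulgA mulVKg.
Qed.

Canonical ideal_equiv :=
  EquivRel ideal_rel ideal_rel_refl ideal_rel_sym ideal_rel_trans.

Definition quot_brace : Type := {eq_quot ideal_equiv}.

HB.instance Definition _ := Choice.on quot_brace.
HB.instance Definition _ := EqQuotient.on quot_brace.

Definition quot_pi (h : H) : quot_brace := \pi_quot_brace h.

Lemma quot_piP x y : reflect (quot_pi x = quot_pi y) (ideal_rel x y).
Proof. by apply: (iffP idP) => [/eqmodP|/eqmodP]. Qed.

Lemma quot_pi_repr (q : quot_brace) : quot_pi (repr q) = q.
Proof. exact: reprK. Qed.

Lemma quot_pi_ind (P : quot_brace -> Prop) : (forall h, P (quot_pi h)) -> forall q, P q.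
Proof. by move=> Ppi q; rewrite -(quot_pi_repr q). Qed.

Lemma repr_quot_pi h : ideal_rel (repr (quot_pi h)) h.
Proof. by apply/quot_piP; rewrite quot_pi_repr. Qed.

Definition quot_mul (p q : quot_brace) := quot_pi (repr p * repr q).
Definition quot_inv (p : quot_brace) := quot_pi (repr p)^-1.
Definition quot_circ (p q : quot_brace) := quot_pi (repr p ∘ repr q).
Definition quot_cinv (p : quot_brace) := quot_pi (repr p)^†.

Lemma quot_relP x y : ideal_rel x y -> exists2 i, (I : set H) i & y = x * i.
Proof. by move=> /asboolP ?; exists (x^-1 * y); rewrite ?mulVKg. Qed.

Lemma quot_rel_mulr x i : (I : set H) i -> ideal_rel x (x * i).
Proof. by move=> Ii; apply/asboolP; rewrite mulKg. Qed.

Lemma quot_rel_circP x y : ideal_rel x y -> exists2 i, (I : set H) i & y = x ∘ i.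
Proof.
move=> /quot_relP[i Ii ->]; exists (lam x^† i); first exact: ideal_lam.
by rewrite circE -lam_circ circxV1 lam1x.
Qed.

Lemma quot_rel_circr x i : (I : set H) i -> ideal_rel x (x ∘ i).
Proof. by move=> Ii; rewrite circE; apply/quot_rel_mulr/ideal_lam. Qed.

Lemma quot_mulE x y : quot_mul (quot_pi x) (quot_pi y) = quot_pi (x * y).
Proof.
rewrite /quot_mul; apply/quot_piP; case: (ideal_add_normal I) => -[_ IM _] IJ.
have /quot_relP[i Ii ex] := repr_quot_pi x.
have /quot_relP[j Ij ey] := repr_quot_pi y.
rewrite [in X in ideal_rel _ X]ex [in X in ideal_rel _ X]ey.
set x' := repr _; set y' := repr _.
have -> : x' * i * (y' * j) = x' * y' * (y'^-1 * i * y' * j).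
  by rewrite !mulgA mulgK.
apply: quot_rel_mulr; apply: IM => //.
by have := IJ y'^-1 _ Ii; rewrite invgK.
Qed.

Lemma quot_invE x : quot_inv (quot_pi x) = quot_pi x^-1.
Proof.
rewrite /quot_inv; apply/quot_piP; case: (ideal_add_normal I) => -[_ _ IV] IJ.
have /quot_relP[i Ii ex] := repr_quot_pi x.
rewrite [in X in ideal_rel _ X]ex; set x' := repr _.
rewrite invgM; apply/asboolP; rewrite invgK mulgA.
exact/IJ/IV.
Qed.

Lemma quot_circE x y : quot_circ (quot_pi x) (quot_pi y) = quot_pi (x ∘ y).
Proof.
rewrite /quot_circ; apply/quot_piP; case: (ideal_circ_normal I) => -[_ IM _] IJ.
have /quot_rel_circP[i Ii ex] := repr_quot_pi x.
have /quot_rel_circP[j Ij ey] := repr_quot_pi y.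
rewrite [in X in ideal_rel _ X]ex [in X in ideal_rel _ X]ey.
set x' := repr _; set y' := repr _.
have -> : x' ∘ i ∘ (y' ∘ j) = x' ∘ y' ∘ (y'^† ∘ i ∘ y' ∘ j).
  by rewrite !circA circKr.
apply: quot_rel_circr; apply: IM => //.
by have := IJ y'^† _ Ii; rewrite cinvK.
Qed.

Lemma quot_cinvE x : quot_cinv (quot_pi x) = quot_pi x^†.
Proof.
rewrite /quot_cinv; apply/quot_piP; case: (ideal_circ_normal I) => -[_ _ IV] IJ.
have /quot_rel_circP[i Ii ex] := repr_quot_pi x.
rewrite [in X in ideal_rel _ X]ex; set x' := repr _.
have -> : (x' ∘ i)^† = x'^† ∘ (x' ∘ i^† ∘ x'^†).
  by apply: cinvE; rewrite -(circA x' i^†) circK -circA circVK circxV1.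
exact/quot_rel_circr/IJ/IV.
Qed.

Lemma quot_mulA : associative quot_mul.
Proof.
elim/quot_pi_ind=> x; elim/quot_pi_ind=> y; elim/quot_pi_ind=> z.
by rewrite !quot_mulE mulgA.
Qed.
Lemma quot_mul1 : left_id (quot_pi 1) quot_mul.
Proof. by elim/quot_pi_ind=> x; rewrite quot_mulE mul1g. Qed.
Lemma quot_mulx1 : right_id (quot_pi 1) quot_mul.
Proof. by elim/quot_pi_ind=> x; rewrite quot_mulE mulg1. Qed.
Lemma quot_mulV : left_inverse (quot_pi 1) quot_inv quot_mul.
Proof. by elim/quot_pi_ind=> x; rewrite quot_invE quot_mulE mulVg. Qed.
Lemma quot_mulxV : right_inverse (quot_pi 1) quot_inv quot_mul.
Proof. by elim/quot_pi_ind=> x; rewrite quot_invE quot_mulE mulgV. Qed.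

HB.instance Definition _ := isGroup.Build quot_brace
  quot_mulA quot_mul1 quot_mulx1 quot_mulV quot_mulxV.

Lemma quot_circA : associative quot_circ.
Proof.
elim/quot_pi_ind=> x; elim/quot_pi_ind=> y; elim/quot_pi_ind=> z.
by rewrite !quot_circE circA.
Qed.
Lemma quot_circ1 : left_id (quot_pi cone) quot_circ.
Proof. by elim/quot_pi_ind=> x; rewrite quot_circE circ1x. Qed.
Lemma quot_circx1 : right_id (quot_pi cone) quot_circ.
Proof. by elim/quot_pi_ind=> x; rewrite quot_circE circx1. Qed.
Lemma quot_circV : left_inverse (quot_pi cone) quot_cinv quot_circ.
Proof. by elim/quot_pi_ind=> x; rewrite quot_cinvE quot_circE circVx. Qed.
Lemma quot_circxV : right_inverse (quot_pi cone) quot_cinv quot_circ.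
Proof. by elim/quot_pi_ind=> x; rewrite quot_cinvE quot_circE circxV. Qed.
Lemma quot_circM (p q r : quot_brace) :
  quot_circ p (q * r) = quot_circ p q * p^-1 * quot_circ p r.
Proof.
elim/quot_pi_ind: p => x; elim/quot_pi_ind: q => y; elim/quot_pi_ind: r => z.
rewrite /mul /inv /= !(quot_mulE, quot_circE, quot_invE).
by rewrite circM.
Qed.

HB.instance Definition _ := Group_isSkewLeftBrace.Build quot_brace
  quot_circA quot_circ1 quot_circx1 quot_circV quot_circxV quot_circM.

End QuotientBrace.

Section Annihilator.
Variable H : skewLeftBraceType.

Definition Ann : set H :=
  [set a | forall b : H, [/\ b ∘ a = a ∘ b, a ∘ b = b * a & b * a = a * b]].

Lemma AnnM a c : Ann a -> a ∘ c = a * c.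
Proof. by move=> /(_ c)[_ -> ->]. Qed.

Lemma AnnMr a c : Ann a -> c ∘ a = a * c.
Proof. by move=> /(_ c)[-> -> ->]. Qed.

Lemma AnnC a c : Ann a -> c * a = a * c.
Proof. by move=> /(_ c)[_ _ ->]. Qed.

Lemma Ann_add_normal : normal_subgroup mul 1 inv Ann.
Proof.
split; last by move=> h x Ax; rewrite (AnnC h Ax) mulgK.
split.
- by move=> b; rewrite circ1r circ1l mulg1 mul1g.
- move=> x y Ax Ay b.
  have e1 : b ∘ (x * y) = x * y * b.
    by rewrite -{1}(AnnM y Ax) circA (AnnMr b Ax) (AnnMr _ Ay) mulgA (AnnC y Ax).
  have e2 : x * y ∘ b = x * y * b.
    by rewrite -{1}(AnnM y Ax) -circA (AnnM _ Ay) (AnnM _ Ax) mulgA.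
  have e3 : b * (x * y) = x * y * b.
    by rewrite mulgA (AnnC b Ax) -mulgA (AnnC b Ay) mulgA.
  by rewrite e1 e2 e3.
- move=> x Ax b.
  have xV : x^-1 = x^† by apply/esym/cinvE; rewrite (AnnM _ Ax) mulgV.
  have e1 : x^-1 ∘ b = x^-1 * b.
    by rewrite -{1}(mulVKg x b) -(AnnM _ Ax) xV circK.
  have e2 : b ∘ x^-1 = x^-1 ∘ b.
    rewrite xV -{1}(circVK x b).
    have -> : x ∘ (x^† ∘ b) = (x^† ∘ b) ∘ x by rewrite (AnnM _ Ax) (AnnMr _ Ax).
    by rewrite circKr.
  have e3 : b * x^-1 = x^-1 * b.
    by apply: (@mulgI _ x); rewrite mulVKg mulgA -(AnnC b Ax) mulgK.
  by rewrite e2 e1 e3.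
Qed.

Lemma Ann_lam (h x : H) : Ann x -> Ann (lam h x).
Proof. by move=> Ax; rewrite /lam (AnnMr h Ax) -(AnnC h Ax) mulKg. Qed.

Lemma Ann_conj (h x : H) : Ann x -> Ann (h ∘ x ∘ h^†).
Proof. by move=> Ax; rewrite (AnnMr h Ax) -(AnnM h Ax) circKr. Qed.

Definition Ann_ideal : ideal H := mk_ideal Ann_add_normal Ann_lam Ann_conj.

End Annihilator.
Arguments Ann H : clear implicits.
Arguments Ann_ideal H : clear implicits.

Section Commutator.
Variable H : skewLeftBraceType.

Definition add_gen (S : set H) : set H :=
  smallest (subgroup mul 1 inv) S.

Definition add_derived : set H :=
  add_gen [set x * y * x^-1 * y^-1 | x in [set: H] & y in [set: H]].

Definition comm : set H :=
  add_gen (add_derived `|`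
    [set a^-1 * (a ∘ b) * b^-1 | a in [set: H] & b in [set: H]]).

Lemma add_gen_sub (S : set H) : S `<=` add_gen S.
Proof. exact: sub_gen_smallest. Qed.

Lemma add_gen_subgroup (S : set H) : subgroup mul 1 inv (add_gen S).
Proof.
split.
- by move=> K [[]].
- by move=> x y Sx Sy K KS; case: (KS) => -[_ KM _] _; exact: KM (Sx K KS) (Sy K KS).
- by move=> x Sx K KS; case: (KS) => -[_ _ KV] _; exact: KV (Sx K KS).
Qed.

Lemma comm_theta (a b : H) : comm (a * b * a^-1 * b^-1).
Proof.
by apply: add_gen_sub; left; apply: add_gen_sub; exists a => //; exists b.
Qed.

Lemma comm_theta_star (a b : H) : comm (lam a b * b^-1).
Proof. by apply: add_gen_sub; right; exists a => //; exists b. Qed.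

Lemma comm_add_normal : normal_subgroup mul 1 inv comm.
Proof.
split; first exact: add_gen_subgroup.
move=> h x Cx; have [_ CM _] := add_gen_subgroup (add_derived `|`
    [set a^-1 * (a ∘ b) * b^-1 | a in [set: H] & b in [set: H]]).
by have := CM _ _ (comm_theta h x) Cx; rewrite mulgVK.
Qed.

Lemma comm_lam (h x : H) : comm x -> comm (lam h x).
Proof.
case: comm_add_normal => -[_ CM _] _ Cx.
by have := CM _ _ (comm_theta_star h x) Cx; rewrite mulgVK.
Qed.

Lemma comm_conj (h x : H) : comm x -> comm (h ∘ x ∘ h^†).
Proof.
case: comm_add_normal => -[_ CM CV] CJ Cx.
have -> : h ∘ x ∘ h^† = h * (lam h x * (lam h (lam x h^†) * (lam h h^†)^-1)) * h^-1.
  have -> : (lam h h^†)^-1 = h by rewrite /lam circxV1 mulg1 invgK.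
  rewrite (circE (h ∘ x)) lam_circ (circE h x).
  by move: (lam h x) (lam h (lam x _)) => p q; rewrite !mulgA mulgK.
apply: CJ; apply: CM; first exact: comm_lam.
by rewrite -lamV -lamM; exact: comm_lam (comm_theta_star _ _).
Qed.

Definition comm_ideal : ideal H := mk_ideal comm_add_normal comm_lam comm_conj.

End Commutator.
Arguments comm H : clear implicits.
Arguments comm_ideal H : clear implicits.

Definition ann_quot (H : skewLeftBraceType) : skewLeftBraceType :=
  quot_brace (Ann_ideal H).
Definition comm_brace (H : skewLeftBraceType) : skewLeftBraceType :=
  sub_brace (comm_ideal H).

Section Theta.
Variable H : skewLeftBraceType.

Definition ann_pi (a : H) : ann_quot H := quot_pi (Ann_ideal H) a.

Definition comm_theta_elt (a b : H) : comm_brace H :=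
  @sub_mk H (comm_ideal H) (a * b * a^-1 * b^-1) (comm_theta a b).
Definition comm_theta_star_elt (a b : H) : comm_brace H :=
  @sub_mk H (comm_ideal H) (lam a b * b^-1) (comm_theta_star a b).

(* Defined through representatives; [thetaE] and [theta_starE] show that the
   choice is irrelevant. *)
Definition theta (p q : ann_quot H) : comm_brace H :=
  comm_theta_elt (repr (p : quot_brace (Ann_ideal H)))
                 (repr (q : quot_brace (Ann_ideal H))).
Definition theta_star (p q : ann_quot H) : comm_brace H :=
  comm_theta_star_elt (repr (p : quot_brace (Ann_ideal H)))
                      (repr (q : quot_brace (Ann_ideal H))).

Lemma thetaE (a b : H) : theta (ann_pi a) (ann_pi b) = comm_theta_elt a b.
Proof.
apply: val_inj; rewrite /theta /=.
have /quot_relP[i Ai ea] := repr_quot_pi (Ann_ideal H) a.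
have /quot_relP[j Aj eb] := repr_quot_pi (Ann_ideal H) b.
rewrite /ann_pi; set a' := repr _ in ea *; set b' := repr _ in eb *.
have E x y : x * y * x^-1 * y^-1 = (x * y) / (y * x) :> H by rewrite invgM mulgA.
have e1 : a * b = a' * b' * (i * j).
  by rewrite ea eb -!mulgA (mulgA i b' j) -(AnnC b' Ai) -mulgA.
have e2 : b * a = b' * a' * (i * j).
  by rewrite ea eb -!mulgA (mulgA j a' i) -(AnnC a' Aj) -mulgA (AnnC j Ai).
by rewrite !E e1 e2 mulgKA.
Qed.

Lemma theta_starE (a b : H) :
  theta_star (ann_pi a) (ann_pi b) = comm_theta_star_elt a b.
Proof.
apply: val_inj; rewrite /theta_star /=.
have /quot_relP[i Ai ea] := repr_quot_pi (Ann_ideal H) a.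
have /quot_relP[j Aj eb] := repr_quot_pi (Ann_ideal H) b.
rewrite /ann_pi; set a' := repr _ in ea *; set b' := repr _ in eb *.
have lamAnn h x : Ann H x -> lam h x = x.
  by move=> Ax; rewrite /lam (AnnMr h Ax) -(AnnC h Ax) mulKg.
have Annlam x h : Ann H x -> lam x h = h.
  by move=> Ax; rewrite /lam (AnnM h Ax) mulKg.
rewrite ea eb (AnnC a' Ai) -(AnnMr a' Ai) lam_circ (Annlam i) // lamM.
by rewrite (lamAnn _ j) // invgM mulgA mulgK.
Qed.

End Theta.

Definition brace_iso (A B : skewLeftBraceType) (f : A -> B) : Prop :=
  [/\ bijective f, {morph f : x y / x * y} & {morph f : x y / x ∘ y}].

Definition isoclinic (A B : skewLeftBraceType) : Prop :=
  exists (xi1 : ann_quot A -> ann_quot B) (xi2 : comm_brace A -> comm_brace B),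
    [/\ brace_iso xi1, brace_iso xi2,
        forall p q, xi2 (theta p q) = theta (xi1 p) (xi1 q)
      & forall p q, xi2 (theta_star p q) = theta_star (xi1 p) (xi1 q)].

(* A copy of the product type, so as to avoid the componentwise group
   structure. *)
Definition square (H : skewLeftBraceType) : Type := (H * H)%type.

Section Square.
Variable H : skewLeftBraceType.

HB.instance Definition _ := Choice.on (square H).

Implicit Types x y z : square H.

Definition sq_one : square H := (1, 1).
Definition sq_mul x y : square H := (x.1 * lam x.2 y.1, x.2 ∘ y.2).
Definition sq_inv x : square H := (lam x.2^† x.1^-1, x.2^†).
Definition sq_circ x y : square H := (x.1 ∘ y.1, x.1 ∘ y.2 ∘ x.1^† ∘ x.2).
Definition sq_cinv x : square H := (x.1^†, x.1^† ∘ x.2^† ∘ x.1).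

Lemma sq_mulA : associative sq_mul.
Proof. by move=> x y z; rewrite /sq_mul /= lamM lam_circ mulgA circA. Qed.
Lemma sq_mul1 : left_id sq_one sq_mul.
Proof. by case=> a b; rewrite /sq_mul /= lam1x mul1g circ1l. Qed.
Lemma sq_mulx1 : right_id sq_one sq_mul.
Proof. by case=> a b; rewrite /sq_mul /= lam1 mulg1 circ1r. Qed.
Lemma sq_mulV : left_inverse sq_one sq_inv sq_mul.
Proof. by case=> a b; rewrite /sq_mul /sq_inv /= -lamM mulVg lam1 circVx1. Qed.
Lemma sq_mulxV : right_inverse sq_one sq_inv sq_mul.
Proof.
case=> a b.
by rewrite /sq_mul /sq_inv /= -lam_circ circxV1 lam1x mulgV.
Qed.

HB.instance Definition _ := isGroup.Build (square H)
  sq_mulA sq_mul1 sq_mulx1 sq_mulV sq_mulxV.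

Lemma cinv_circ (a b : H) : (a ∘ b)^† = b^† ∘ a^†.
Proof. by apply: cinvE; rewrite circA circKr circxV1. Qed.

Lemma sq_circA : associative sq_circ.
Proof. by move=> x y z; rewrite /sq_circ /= cinv_circ !circA circVKr. Qed.
Lemma sq_circ1 : left_id sq_one sq_circ.
Proof.
case=> a b; have e : (1 : H)^† = 1 by apply: cinvE; rewrite circ1l.
by rewrite /sq_circ /= e !circ1l !circ1r.
Qed.
Lemma sq_circx1 : right_id sq_one sq_circ.
Proof. by case=> a b; rewrite /sq_circ /= !circ1r circxV1 circ1l. Qed.
Lemma sq_circV : left_inverse sq_one sq_cinv sq_circ.
Proof.
case=> a b; rewrite /sq_circ /sq_cinv /= cinvK circVx1.
by rewrite !circA !circKr circVx1.
Qed.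
Lemma sq_circxV : right_inverse sq_one sq_cinv sq_circ.
Proof.
case=> a b; rewrite /sq_circ /sq_cinv /= circxV1.
by rewrite !circA circxV1 circ1l circKr circVx1.
Qed.
Lemma sq_circM x y z : sq_circ x (y * z) = sq_circ x y * x^-1 * sq_circ x z.
Proof.
case: x y z => [h1 g1] [h2 g2] [h3 g3].
rewrite /mul /inv /= /sq_circ /sq_mul /sq_inv /=; congr (_, _); last first.
  by rewrite !circA circKr circVKr.
rewrite -lam_circ circKr -mulgA -lamM -/(lam h1 h3) -lam_circ circVKr lam_circ.
by rewrite circE lamM mulgA -circE.
Qed.

HB.instance Definition _ := Group_isSkewLeftBrace.Build (square H)
  sq_circA sq_circ1 sq_circx1 sq_circV sq_circxV sq_circM.

End Square.

(* Main.v *)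
Require Import Defs.
From mathcomp Require Import all_boot.
From mathcomp Require Import boolp classical_sets.
Local Open Scope classical_set_scope.

(** An isoclinism [(xi1, xi2)] from [A] to [B] is faithfully described by two
    relations between [A] and [B]: the pullback [R] of the graph of [xi1], and
    the graph [S] of [xi2] restricted to [R].  In this language [R] is a
    sub-skew-brace of [A * B] projecting onto both factors and matching the two
    annihilators, while [S] is a subgroup of [R] that is the graph of an
    injection and contains every pair of corresponding values of theta and
    theta_star.  Lemmas [isoclinism_rel_of_isoclinic] and
    [isoclinic_of_isoclinism_rel] translate in both directions.

    Saying that [S] contains these values says that [S] is an ideal of [R] with
    [R / S] an abelian group on which the two operations coincide.  So a pair
    of elements produced by one word from [R]-related entries lies in [S]
    as soon as that word is trivial in every such group.  The values of theta
    and theta_star on the square of [A] are pairs of words of this kind: with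
    [c = g1 ∘ g2 ∘ g1^† ∘ g2^†] and [P = h2 * lam g2 h1], the commutator of
    [(h1, g1)] and [(h2, g2)] is
    [(h1 * lam g1 h2 * P^-1 * (lam c P * P^-1)^-1, c)], and, with
    [u = g1^† ∘ h1] and [d = u ∘ g2 ∘ u^† ∘ g2^†], the value of theta_star is
    [((lam u h2 * h2^-1) * (lam d h2 * h2^-1)^-1, d)].  Therefore [R] and [S],
    taken componentwise, satisfy the same axioms between the two squares; the
    hypotheses on the annihilators of the squares say exactly that the
    componentwise [R] matches annihilators. *)

Section Isoclinism.
Set Implicit Arguments.
Unset Strict Implicit.
Unset Printing Implicit Defensive.
Local Open Scope group_scope.

(** * Isoclinisms as pairs of relations *)

Record isoclinism_rel (A B : skewLeftBraceType) (R S : A -> B -> Prop) : Prop :=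
  IsoclinismRel {
  irel_totall : forall a, exists b, R a b;
  irel_totalr : forall b, exists a, R a b;
  irelM : forall a b a' b', R a b -> R a' b' -> R (a * a') (b * b');
  irelV : forall a b, R a b -> R a^-1 b^-1;
  irel_circ : forall a b a' b', R a b -> R a' b' -> R (a ∘ a') (b ∘ b');
  irel_cinv : forall a b, R a b -> R a^† b^†;
  irel_Ann : forall a b, R a b -> Ann A a <-> Ann B b;
  icom1 : S 1 1;
  icomM : forall a b a' b', S a b -> S a' b' -> S (a * a') (b * b');
  icomV : forall a b, S a b -> S a^-1 b^-1;
  icom_rel : forall a b, S a b -> R a b;
  icom_eq1 : forall a b, S a b -> a = 1 <-> b = 1;
  icom_theta : forall a b a' b', R a b -> R a' b' ->
    S (a * a' * a^-1 * a'^-1) (b * b' * b^-1 * b'^-1);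
  icom_theta_star : forall a b a' b', R a b -> R a' b' ->
    S (lam a a' * a'^-1) (lam b b' * b'^-1) }.

Lemma isoclinism_rel_sym (A B : skewLeftBraceType) (R S : A -> B -> Prop) :
  isoclinism_rel R S -> isoclinism_rel (fun b a => R a b) (fun b a => S a b).
Proof.
case=> tl tr rM rV rc rcV rA s1 sM sV sR sE st sts.
by split=> //; intros; eauto; symmetry; eauto.
Qed.

(** * From maps to relations *)

Section OfMaps.
Variables (A B : skewLeftBraceType) (f : A -> B).
Hypothesis isof : brace_iso f.

Lemma brace_iso1 : f 1 = 1.
Proof. by case: isof => _ fM _; apply: (@mulgI _ (f 1)); rewrite -fM !mulg1. Qed.

Lemma brace_isoV a : f a^-1 = (f a)^-1.
Proof.
by case: isof => _ fM _; apply/esym/mulg1_eq; rewrite -fM mulgV brace_iso1.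
Qed.

Lemma brace_iso_cinv a : f a^† = (f a)^†.
Proof.
by case: isof => _ _ fC; apply/esym/cinvE; rewrite -fC circxV1 brace_iso1.
Qed.

End OfMaps.

Section AnnPi.
Variable A : skewLeftBraceType.
Implicit Types a b : A.

Lemma ann_piM a b : ann_pi (a * b) = ann_pi a * ann_pi b.
Proof. exact/esym/quot_mulE. Qed.

Lemma ann_piV a : ann_pi a^-1 = (ann_pi a)^-1.
Proof. exact/esym/quot_invE. Qed.

Lemma ann_pi_circ a b : ann_pi (a ∘ b) = ann_pi a ∘ ann_pi b.
Proof. exact/esym/quot_circE. Qed.

Lemma ann_pi_cinv a : ann_pi a^† = (ann_pi a)^†.
Proof. exact/esym/quot_cinvE. Qed.

Lemma ann_pi_eqP a b : ann_pi a = ann_pi b <-> Ann A (a^-1 * b).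
Proof. by split=> [/quot_piP/asboolP|h] //; apply/quot_piP/asboolP. Qed.

Lemma ann_pi_eq1 a : ann_pi a = 1 <-> Ann A a.
Proof.
rewrite (_ : 1 = ann_pi (1 : A)) //; split=> [/esym|h]; last apply/esym.
  by move/ann_pi_eqP; rewrite invg1 mul1g.
by apply/ann_pi_eqP; rewrite invg1 mul1g.
Qed.

End AnnPi.

(** Intersecting the graph of [xi2] with [R] costs nothing, because [R] is
    closed under all operations and so contains the theta and theta_star
    values; it spares showing that [xi1] and [xi2] agree on the commutator
    modulo annihilators. *)
Lemma isoclinism_rel_of_isoclinic (A B : skewLeftBraceType) :
  isoclinic A B -> exists R S : A -> B -> Prop, isoclinism_rel R S.
Proof.
case=> xi1 [xi2 [iso1 iso2 xit xits]].
have [[eta1 etaK etaK'] xi1M xi1C] := iso1; have [bij2 xi2M _] := iso2.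
pose R (a : A) (b : B) := xi1 (ann_pi a) = ann_pi b.
pose G (a : A) (b : B) := exists2 x, val x = a & val (xi2 x) = b.
have RM a b a' b' : R a b -> R a' b' -> R (a * a') (b * b').
  by rewrite /R !ann_piM xi1M => -> ->.
have RV a b : R a b -> R a^-1 b^-1 by rewrite /R !ann_piV (brace_isoV iso1) => ->.
have RC a b a' b' : R a b -> R a' b' -> R (a ∘ a') (b ∘ b').
  by rewrite /R !ann_pi_circ xi1C => -> ->.
exists R, (fun a b => G a b /\ R a b); split=> //.
- by move=> a; exists (repr (xi1 (ann_pi a))); rewrite /R /ann_pi quot_pi_repr.
- move=> b; exists (repr (eta1 (ann_pi b))).
  by rewrite /R {1}/ann_pi quot_pi_repr etaK'.
- by move=> a b; rewrite /R !ann_pi_cinv (brace_iso_cinv iso1) => ->.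
- move=> a b Rab; rewrite -!ann_pi_eq1 -Rab -(brace_iso1 iso1).
  by split=> [->//|]; apply: (can_inj etaK).
- split; first by exists 1; rewrite ?(brace_iso1 iso2).
  by rewrite /R; exact: brace_iso1 iso1.
- move=> a b a' b' [[x <- <-] Rab] [[x' <- <-] Rab'].
  by split; [exists (x * x'); rewrite ?xi2M|exact: RM].
- move=> a b [[x <- <-] Rab].
  by split; [exists x^-1; rewrite ?(brace_isoV iso2)|exact: RV].
- by move=> a b [].
- move=> a b [[x <- <-] _]; split=> [x1|fx1].
    by rewrite (_ : x = 1) ?(brace_iso1 iso2) //; apply: val_inj.
  have : xi2 x = 1 by apply: val_inj.
  by rewrite -(brace_iso1 iso2) => /(bij_inj bij2) ->.
- move=> a b a' b' Rab Rab'; split; last first.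
    by apply: (RM _ _ _ _ (RM _ _ _ _ (RM _ _ _ _ Rab Rab') _)); exact: RV.
  by exists (theta (ann_pi a) (ann_pi a')); rewrite ?xit ?Rab ?Rab' thetaE.
- move=> a b a' b' Rab Rab'; split; last first.
    by apply: (RM); [apply: RM; [exact: RV|exact: RC]|exact: RV].
  by exists (theta_star (ann_pi a) (ann_pi a')); rewrite ?xits ?Rab ?Rab' theta_starE.
Qed.

(** * From relations to maps *)

Section Transfer.
Variables (A B : skewLeftBraceType) (R S : A -> B -> Prop).
Hypothesis irel : isoclinism_rel R S.

Lemma irel_lam a b a' b' : R a b -> R a' b' -> R (lam a a') (lam b b').
Proof.
move=> Rab Rab'; apply: (irelM irel); first exact: (irelV irel).
exact: (irel_circ irel).
Qed.

(** [S] is an ideal of [R]: [lam a x] is [x] times a theta_star value, and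
    likewise a conjugate is a multiple by a theta value.  This needs [x] and [y]
    to be [R]-related, which is why [S] is required to lie in [R]. *)
Lemma icom_lam a b x y : R a b -> S x y -> S (lam a x) (lam b y).
Proof.
move=> Rab Sxy.
have := icomM irel (icom_theta_star irel Rab (icom_rel irel Sxy)) Sxy.
by rewrite !mulgVK.
Qed.

Lemma icom_conj a b x y : R a b -> S x y -> S (a * x * a^-1) (b * y * b^-1).
Proof.
move=> Rab Sxy.
have := icomM irel (icom_theta irel Rab (icom_rel irel Sxy)) Sxy.
by rewrite !mulgVK.
Qed.

Lemma icom_circ x y x' y' : S x y -> S x' y' -> S (x ∘ x') (y ∘ y').
Proof.
move=> Sxy Sxy'; rewrite !circE; apply: (icomM irel) => //.
exact: icom_lam (icom_rel irel Sxy) Sxy'.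
Qed.

Lemma icom_cinv x y : S x y -> S x^† y^†.
Proof.
move=> Sxy; rewrite (cinv_lam x) (cinv_lam y); apply: (icomV irel).
exact: icom_lam (irel_cinv irel (icom_rel irel Sxy)) Sxy.
Qed.

Lemma irel_ann_pi a b a' b' :
  R a b -> R a' b' -> ann_pi a = ann_pi a' <-> ann_pi b = ann_pi b'.
Proof.
move=> Rab Rab'; rewrite !ann_pi_eqP; apply: (irel_Ann irel).
exact: (irelM irel) (irelV irel Rab) Rab'.
Qed.

Lemma icom_inj x y x' y' : S x y -> S x' y' -> x = x' <-> y = y'.
Proof.
move=> Sxy Sxy'; have := icom_eq1 irel (icomM irel Sxy (icomV irel Sxy')).
have E (T : groupType) (u v : T) : u * v^-1 = 1 <-> u = v.
  by split=> [e|->]; rewrite ?mulgV //; apply: (@mulIg _ v^-1); rewrite mulgV.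
by rewrite !E.
Qed.

(** The commutator is generated by theta and theta_star values, and these have
    partners because [R] is total. *)
Lemma icom_total x : comm A x -> exists2 y, comm B y & S x y.
Proof.
have [[[C1 CM CV] _] tot] := (comm_add_normal B, irel_totall irel).
pose K : set A := [set x | exists2 y, comm B y & S x y].
have sub : subgroup mul 1 inv K.
  split; first by exists 1 => //; exact: icom1 irel.
    move=> u v [y Cy Suy] [z Cz Svz].
    by exists (y * z); [exact: CM|exact: (icomM irel Suy Svz)].
  by move=> u [y Cy Suy]; exists y^-1; [exact: CV|exact: (icomV irel Suy)].
move=> Cx; apply: (Cx K); split=> // {x Cx}.
move=> x [Dx|[a _ [a' _ <-]]]; last first.
  have [[b Rab] [b' Rab']] := (tot a, tot a').
  exists (lam b b' * b'^-1); first exact: comm_theta_star.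
  exact: (icom_theta_star irel Rab Rab').
apply: (Dx K); split=> // {x Dx} x [a _ [a' _ <-]].
have [[b Rab] [b' Rab']] := (tot a, tot a').
exists (b * b' * b^-1 * b'^-1); first exact: comm_theta.
exact: (icom_theta irel Rab Rab').
Qed.

Lemma ann_quot_map : exists f : ann_quot A -> ann_quot B,
  forall a b, R a b -> f (ann_pi a) = ann_pi b.
Proof.
have /choice[r rP] := irel_totall irel.
exists (fun p => ann_pi (r (repr p))) => a b Rab.
apply/(irel_ann_pi (rP _) Rab); exact: quot_pi_repr.
Qed.

Lemma comm_map : exists f : comm_brace A -> comm_brace B,
  forall x, S (val x) (val (f x)).
Proof.
have /choice[f fP] : forall x : comm_brace A, exists y : comm_brace B,
    S (val x) (val y).
  move=> x; have [y Cy Sxy] := icom_total (subP (I := comm_ideal A) x).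
  by exists (sub_mk (I := comm_ideal B) Cy).
by exists f.
Qed.

End Transfer.

Lemma isoclinic_of_isoclinism_rel (A B : skewLeftBraceType) (R S : A -> B -> Prop) :
  isoclinism_rel R S -> isoclinic A B.
Proof.
move=> irel; have irel' := isoclinism_rel_sym irel.
have [[xi1 xi1P] [xi2 xi2P]] := (ann_quot_map irel, comm_map irel).
have [[eta1 eta1P] [eta2 eta2P]] := (ann_quot_map irel', comm_map irel').
have tot := irel_totall irel.
(* [S] is the graph of an injection, so it determines [xi2] *)
have xi2E x y : S (val x) (val y) -> xi2 x = y.
  by move=> Sxy; apply: val_inj; apply/(icom_inj irel (xi2P x) Sxy).
exists xi1, xi2; split.
- split.
  + exists eta1.
      elim/quot_pi_ind=> a; have [b Rab] := tot a.
      by rewrite (xi1P _ _ Rab) (eta1P _ _ Rab).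
    elim/quot_pi_ind=> b; have [a Rab] := irel_totalr irel b.
    by rewrite (eta1P _ _ Rab) (xi1P _ _ Rab).
  + elim/quot_pi_ind=> a; elim/quot_pi_ind=> a'.
    have [[b Rab] [b' Rab']] := (tot a, tot a').
    rewrite -!/(ann_pi _) -ann_piM (xi1P _ _ Rab) (xi1P _ _ Rab') -ann_piM.
    exact: xi1P (irelM irel Rab Rab').
  + elim/quot_pi_ind=> a; elim/quot_pi_ind=> a'.
    have [[b Rab] [b' Rab']] := (tot a, tot a').
    rewrite -!/(ann_pi _) -ann_pi_circ (xi1P _ _ Rab) (xi1P _ _ Rab') -ann_pi_circ.
    exact: xi1P (irel_circ irel Rab Rab').
- split.
  + exists eta2 => x; last exact: xi2E (eta2P x).
    by apply: val_inj; apply/(icom_inj irel' (eta2P _) (xi2P x)).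
  + by move=> x x'; apply: xi2E; exact: (icomM irel (xi2P x) (xi2P x')).
  + by move=> x x'; apply: xi2E; exact: (icom_circ irel (xi2P x) (xi2P x')).
- elim/quot_pi_ind=> a; elim/quot_pi_ind=> a'.
  have [[b Rab] [b' Rab']] := (tot a, tot a').
  rewrite -!/(ann_pi _) (xi1P _ _ Rab) (xi1P _ _ Rab') !thetaE.
  by apply: xi2E; exact: (icom_theta irel Rab Rab').
- elim/quot_pi_ind=> a; elim/quot_pi_ind=> a'.
  have [[b Rab] [b' Rab']] := (tot a, tot a').
  rewrite -!/(ann_pi _) (xi1P _ _ Rab) (xi1P _ _ Rab') !theta_starE.
  by apply: xi2E; exact: (icom_theta_star irel Rab Rab').
Qed.

(** * Commutators of the square *)

Section SquareWords.
Variable A : skewLeftBraceType.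
Implicit Types a b g h u : A.

Definition circ_commutator a b : A := a ∘ b ∘ a^† ∘ b^†.

(** A word that vanishes when [lam] is trivial and the addition commutative is
    written as a product of conjugates of theta and theta_star values and their
    inverses; the circle commutator and both components of [square_theta] reduce
    to it. *)
Lemma lam_cross g1 g2 h1 h2 :
  h1 * lam g1 h2 * (h2 * lam g2 h1)^-1 =
  h1 * (lam g1 h2 * h2^-1) * h1^-1 * (h1 * h2 * h1^-1 * h2^-1)
    * (h2 * (lam g2 h1 * h1^-1) * h2^-1)^-1.
Proof. by rewrite !invgM !invgK !mulgA !mulgVK. Qed.

(** Obtained from [g1 ∘ g2 = c ∘ (g2 ∘ g1) = c * lam c (g2 ∘ g1)].  Although [c]
    occurs on both sides, the last factor is a theta_star value whatever [c] is,
    so membership of [c] in the commutator follows from [lam_cross]. *)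
Lemma circ_commutatorE g1 g2 (c := circ_commutator g1 g2) (P := g2 ∘ g1) :
  c = g1 * lam g1 g2 * (g2 * lam g2 g1)^-1 * (lam c P * P^-1)^-1.
Proof.
rewrite -!circE -/P.
have -> : g1 ∘ g2 = c * lam c P by rewrite -circE /c /P !circA !circVKr.
by move: (lam c P) => L; rewrite invgM invgK !mulgA mulgVK mulgK.
Qed.

Lemma square_mulE (x y : square A) :
  x * y = (x.1 * lam x.2 y.1, x.2 ∘ y.2) :> square A.
Proof. by []. Qed.

Lemma square_invE (x : square A) : x^-1 = (lam x.2^† x.1^-1, x.2^†) :> square A.
Proof. by []. Qed.

Lemma square_circE (x y : square A) :
  x ∘ y = (x.1 ∘ y.1, x.1 ∘ y.2 ∘ x.1^† ∘ x.2) :> square A.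
Proof. by []. Qed.

Lemma square_theta (x y : square A) (c := circ_commutator x.2 y.2)
    (P := y.1 * lam y.2 x.1) :
  x * y * x^-1 * y^-1 =
  (x.1 * lam x.2 y.1 * P^-1 * (lam c P * P^-1)^-1, c) :> square A.
Proof.
have -> : x * y * x^-1 * y^-1 = (x * y) * (y * x)^-1 :> square A.
  by rewrite invgM mulgA.
rewrite !square_mulE square_invE /= -/P cinv_circ circA -/(circ_commutator _ _).
congr (_, _); rewrite -/c -lam_circ circA -/(circ_commutator _ _) -/c lamV.
by move: (P) (lam c P) (lam x.2 _) => Q L M; rewrite invgM invgK !mulgA mulgVK.
Qed.

Lemma square_theta_star (x y : square A) (u := x.2^† ∘ x.1)
    (c := circ_commutator u y.2) :
  lam x y * y^-1 =
  ((lam u y.1 * y.1^-1) * (lam c y.1 * y.1^-1)^-1, c) :> square A.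
Proof.
rewrite {1}/lam square_circE !square_mulE !square_invE /=.
have e : x.2^† ∘ (x.1 ∘ y.2 ∘ x.1^† ∘ x.2) = u ∘ y.2 ∘ u^†.
  by rewrite /u cinv_circ cinvK !circA.
rewrite e -/(circ_commutator u y.2) -/c; congr (_, _).
rewrite -lamM -/(lam x.1 y.1) -!lam_circ -/u -/c lamV.
by move: (lam c y.1) (lam u y.1) => L M; rewrite invgM invgK !mulgA mulgVK.
Qed.

End SquareWords.

(** * The componentwise isoclinism between squares *)

Section SquareTransfer.
Variables (A B : skewLeftBraceType) (R S : A -> B -> Prop).
Hypothesis irel : isoclinism_rel R S.

Lemma icom_lam_cross g1 g2 h1 h2 g1' g2' h1' h2' :
    R g1 g1' -> R g2 g2' -> R h1 h1' -> R h2 h2' ->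
  S (h1 * lam g1 h2 * (h2 * lam g2 h1)^-1)
    (h1' * lam g1' h2' * (h2' * lam g2' h1')^-1).
Proof.
move=> Rg1 Rg2 Rh1 Rh2; rewrite !lam_cross.
apply: (icomM irel); last first.
  exact: (icomV irel (icom_conj irel Rh2 (icom_theta_star irel Rg2 Rh1))).
apply: (icomM irel) (icom_theta irel Rh1 Rh2).
exact: (icom_conj irel Rh1 (icom_theta_star irel Rg1 Rh2)).
Qed.

Lemma icom_circ_commutator g1 g2 g1' g2' :
  R g1 g1' -> R g2 g2' -> S (circ_commutator g1 g2) (circ_commutator g1' g2').
Proof.
move=> Rg1 Rg2.
have RC := irel_circ irel; have RV := irel_cinv irel.
rewrite (circ_commutatorE g1) (circ_commutatorE g1').
apply: (icomM irel (icom_lam_cross Rg1 Rg2 Rg1 Rg2)); apply: (icomV irel).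
by apply: (icom_theta_star irel); rewrite /circ_commutator; auto 10.
Qed.

Definition square_rel (Q : A -> B -> Prop) (x : square A) (y : square B) : Prop :=
  Q x.1 y.1 /\ Q x.2 y.2.

Lemma square_isoclinism_rel :
    Ann (square A) = Ann A `*` Ann A -> Ann (square B) = Ann B `*` Ann B ->
  isoclinism_rel (square_rel R) (square_rel S).
Proof.
move=> AnnA AnnB.
have RM := irelM irel; have RC := irel_circ irel; have RI := irel_cinv irel.
have RL := irel_lam irel; have RV := irelV irel; have SR := icom_rel irel.
have SI := icom_cinv irel; have SL := icom_lam irel.
split.
- case=> a a'; have [[b ?] [b' ?]] := (irel_totall irel a, irel_totall irel a').
  by exists (b, b').
- case=> b b'; have [[a ?] [a' ?]] := (irel_totalr irel b, irel_totalr irel b').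
  by exists (a, a').
- by move=> x y x' y' [? ?] [? ?]; split; [apply: (RM) => //; apply: RL|exact: RC].
- by move=> x y [? ?]; split; [apply: RL; [exact: RI|exact: RV]|exact: RI].
- by move=> x y x' y' [? ?] [? ?]; split; rewrite /=; auto 10.
- by move=> x y [? ?]; split; rewrite /=; auto 10.
- move=> x y [/(irel_Ann irel) R1 /(irel_Ann irel) R2]; rewrite AnnA AnnB.
  by split=> -[/R1 ? /R2 ?].
- by split; exact: icom1 irel.
- move=> x y x' y' [S1 S2] [S1' S2']; split; last exact: (icom_circ irel).
  by apply: (icomM irel) => //; apply: SL => //; exact: SR.
- move=> x y [S1 S2]; split; last exact: SI.
  by apply: SL; [exact/SR/SI|exact: (icomV irel S1)].
- by move=> x y [? ?]; split; exact: SR.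
- case=> [a a'] [b b'] [/(icom_eq1 irel)/= S1 /(icom_eq1 irel)/= S2].
  by split=> -[/S1-> /S2->].
- move=> x y x' y' [R1 R2] [R1' R2']; rewrite !square_theta.
  have Sc := icom_circ_commutator R2 R2'; split=> //=.
  apply: (icomM irel); first exact: icom_lam_cross.
  apply/(icomV irel)/(icom_theta_star irel); first exact: SR.
  by apply: RM => //; exact: RL.
- move=> x y x' y' [R1 R2] [R1' R2']; rewrite !square_theta_star.
  have Ru := RC _ _ _ _ (RI _ _ R2) R1.
  have Sc := icom_circ_commutator Ru R2'; split=> //=.
  apply: (icomM irel (icom_theta_star irel Ru R1')); apply: (icomV irel).
  exact: (icom_theta_star irel (SR _ _ Sc) R1').
Qed.

End SquareTransfer.
End Isoclinism.

Theorem theorem6p6 (A B : skewLeftBraceType) :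
  isoclinic A B ->
  Ann (square A) = Ann A `*` Ann A ->
  Ann (square B) = Ann B `*` Ann B ->
  isoclinic (square A) (square B).
Proof.
move=> /isoclinism_rel_of_isoclinic[R [S irel]] AnnA AnnB.
exact: isoclinic_of_isoclinism_rel (square_isoclinism_rel irel AnnA AnnB).
Qed.
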